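(* For the preemptive sUETS problem, every online algorithm has competitive ratio $\Omega(m)$ and $\Omega(\log n/\log\log n)$, even when restricted to instances with constant setup times.
   Context: Preemptive sUETS: a finite set $J$ of $n$ jobs and $m$ identical machines, $n\ge m\ge 2$, all jobs available at time $0$. A known setup-time function $c:2^J\to\mathbb{R}_{\ge0}$ is monotone ($c(X)\le c(Y)$ for $X\subseteq Y$) and subadditive ($c(X)+c(Y)\ge c(X\cup Y)$ for disjoint $X,Y$). Each job $j$ has execution time $p_j\ge0$, unknown to an online algorithm until $j$ completes; $p(X)=\sum_{j\in X}p_j$. An algorithm forms batches (sets of jobs not completed and not assigned elsewhere) and assigns each batch to a single machine, which processes batch $X$ in time $c(X)+p(X)$ if uninterrupted. Processing may be preempted: if batch $X$ is preempted $t$ time units after its start, the machine becomes available after at most $c(X)+\max_{j\in X}p_j$ further time units, the set $X'\subseteq X$ of completed jobs satisfies $c(X)+p(X')+\max_{j\in X}p_j\ge t$, completed jobs need not be reprocessed, and uncompleted jobs may be regrouped into new batches (incurring setup again). The makespan is the completion time of all jobs. The optimal makespan is $\min_{(X_1,\dots,X_m)\text{ partition of }J}\max_i(c(X_i)+p(X_i))$. The competitive ratio of an online algorithm is the supremum over instances of its makespan divided by the optimal makespan. Constant setup times: $c(X)=1$ for every nonempty $X\subseteq J$ and $c(\emptyset)=0$. *)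

(* Defs.v *)
(* MathComp / MathComp-Analysis. *)
From HB Require Import structures.
From mathcomp Require Import all_boot all_order all_algebra.
From mathcomp Require Import mathcomp_extra boolp classical_sets reals ereal exp.

Set Implicit Arguments.
Unset Strict Implicit.
Unset Printing Implicit Defensive.
Import Order.TTheory GRing.Theory Num.Theory.
Local Open Scope ring_scope.

Record instance (R : realType) := Instance {
  njobs : nat;
  nmach : nat;
  setup : {set 'I_njobs} -> R;
  ptime : 'I_njobs -> R;
  nmach_bounds : (2 <= nmach <= njobs)%N;
  setup_ge0 : forall X, 0 <= setup X;
  setup_mono : forall X Y : {set 'I_njobs},
    X \subset Y -> setup X <= setup Y;
  setup_subadd : forall X Y : {set 'I_njobs},
    [disjoint X & Y] -> setup (X :|: Y)%SET <= setup X + setup Y;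
  ptime_ge0 : forall j, 0 <= ptime j
}.

Definition constant_setup (R : realType) (I : instance R) : Prop :=
  forall X : {set 'I_(njobs I)}, setup X = (X != finset.set0)%:R.

Section Offline.
Variables (R : realType) (I : instance R).
Notation J := 'I_(njobs I).
Notation M := 'I_(nmach I).

Definition psum (X : {set J}) : R := \sum_(j in X) ptime j.

Definition pmax (X : {set J}) : R := \big[Num.max/0]_(j in X) ptime j.

(* An ordered partition (X_1, ..., X_m) of the jobs, empty parts allowed, is
   given by the function f sending a job to the index of its part. *)
Definition part (f : {ffun J -> M}) (i : M) : {set J} :=
  finset (fun j => f j == i).

Definition offline_makespan (f : {ffun J -> M}) : R :=
  \big[Num.max/0]_(i : M) (setup (part f i) + psum (part f i)).

(* The set of partitions is finite and nonempty, so this infimum is a minimum. *)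
Definition opt : R := inf (range offline_makespan).

End Offline.

(* What is visible of a machine: idle, processing a batch since a given time,
   or preempted on a batch and not yet available again. *)
Variant vstatus (R : realType) (n : nat) :=
  | VIdle
  | VBusy of {set 'I_n} & R
  | VStopping of {set 'I_n}.
Arguments VIdle {R n}.
Arguments VStopping {R n}.

(* [vknown j] is [Some p_j] if job j has completed and [None] otherwise. *)
Record view (R : realType) (n m : nat) := View {
  vnow : R;
  vknown : 'I_n -> option R;
  vmach : 'I_m -> vstatus R n
}.

(* [WaitUntil u] hands control back at the first observable event (completion
   of a job, or a preempted machine becoming available), and at time u at the
   latest. *)
Variant action (R : realType) (n m : nat) :=
  | Start of 'I_m & {set 'I_n}
  | Preempt of 'I_m
  | WaitUntil of R.
Arguments Start {R n m}.
Arguments Preempt {R n m}.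
Arguments WaitUntil {R n m}.

(* A (deterministic) online algorithm knows n, m and the setup function in
   advance; its next action is a function of everything seen so far, oldest
   view first. *)
Definition online_alg (R : realType) :=
  forall n m : nat, ({set 'I_n} -> R) -> seq (view R n m) -> action R n m.

(* Full status of a machine. [Busy s t0]: the batch with elements s was started
   at time t0 and its jobs are run in the order s, which the algorithm neither
   chooses nor sees. [Stopping X X' r]: batch X was preempted, the machine is
   available again at time r, and by then exactly the jobs X' of X are
   completed. *)
Variant status (R : realType) (n : nat) :=
  | Idle
  | Busy of seq 'I_n & R
  | Stopping of {set 'I_n} & {set 'I_n} & R.
Arguments Idle {R n}.
Arguments Stopping {R n}.

Record state (R : realType) (n m : nat) := State {
  now : R;
  completed : {set 'I_n};
  mach : 'I_m -> status R n
}.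

Section Execution.
Variables (R : realType) (I : instance R).
Notation n := (njobs I).
Notation m := (nmach I).
Implicit Types (st : state R n m) (X : {set 'I_n}) (t : R).

Definition batch_of (s : seq 'I_n) : {set 'I_n} := finset (fun j => j \in s).

Definition held (x : status R n) : {set 'I_n} :=
  match x with
  | Idle => finset.set0
  | Busy s _ => batch_of s
  | Stopping X _ _ => X
  end.

Definition is_idle (x : status R n) : bool := if x is Idle then true else false.

Definition completion (s : seq 'I_n) (t0 : R) (j : 'I_n) : R :=
  t0 + setup (batch_of s) + \sum_(k <- take (index j s).+1 s) ptime k.

Definition done_by (s : seq 'I_n) (t0 t : R) : {set 'I_n} :=
  finset (fun j => (j \in s) && (completion s t0 j <= t)).

(* Times of the observable events that have not been delivered yet. *)
Definition pending st : set R := fun t => exists i : 'I_m,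
  match mach st i with
  | Idle => False
  | Busy s t0 =>
      exists j, [/\ j \in s, j \notin completed st & t = completion s t0 j]
  | Stopping _ _ r => t = r
  end.

Definition newly_completed (x : status R n) (t : R) : {set 'I_n} :=
  match x with
  | Idle => finset.set0
  | Busy s t0 => done_by s t0 t
  | Stopping _ X' r => if r <= t then X' else finset.set0
  end.

Definition advance_status (x : status R n) (t : R) : status R n :=
  match x with
  | Idle => Idle
  | Busy s t0 => if batch_of s \subset done_by s t0 t then Idle else x
  | Stopping _ _ r => if r <= t then Idle else x
  end.

Definition advance st (t : R) : state R n m :=
  State t
    (completed st :|: \bigcup_(i : 'I_m) newly_completed (mach st i) t)%SET
    (fun i => advance_status (mach st i) t).

Definition set_status st (i : 'I_m) (x : status R n) : state R n m :=
  State (now st) (completed st) (fun k => if k == i then x else mach st k).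

Definition startable st (i : 'I_m) X : bool :=
  [&& is_idle (mach st i), X != finset.set0, [disjoint X & completed st]
    & [forall k, [disjoint X & held (mach st k)]]].

(* Possible outcomes of preempting, t time units after its start, a batch X on
   which the jobs D are completed already: the machine is available again d time
   units later and exactly the jobs X' of X are completed by then. The last
   condition says that the machine had time to execute the jobs of X'. *)
Definition preempt_outcome X (D : {set 'I_n}) (t : R) (X' : {set 'I_n}) (d : R)
    : Prop :=
  [/\ 0 <= d <= setup X + pmax X,
      D \subset X', X' \subset X,
      t <= setup X + psum X' + pmax X
    & X' = finset.set0 \/ setup X + psum X' <= t + d].

(* [step a st st']: action a in state st may lead to st'. What the model leaves
   open (processing order in a batch, outcome of a preemption) is
   nondeterministic. Illegal actions change nothing; an algorithm that insists on
   them never completes. *)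
Definition step (a : action R n m) st (st' : state R n m) : Prop :=
  match a with
  | Start i X =>
      if startable st i X then
        exists s : seq 'I_n,
          [/\ uniq s, batch_of s = X & st' = set_status st i (Busy s (now st))]
      else st' = st
  | Preempt i =>
      match mach st i with
      | Busy s t0 =>
          exists (X' : {set 'I_n}) (d : R),
            preempt_outcome (batch_of s) (done_by s t0 (now st)) (now st - t0)
              X' d
            /\ st' = set_status st i (Stopping (batch_of s) X' (now st + d))
      | _ => st' = st
      end
  | WaitUntil u =>
      let u' := Num.max (now st) u in
      exists t, [/\ now st <= t <= u',
                    forall t', pending st t' -> t <= t',
                    t = u' \/ pending st t
                  & st' = advance st t]
  end.

Definition view_of st : view R n m :=
  View (now st)
    (fun j => if j \in completed st then Some (ptime j) else None)
    (fun i => match mach st i with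
              | Idle => VIdle
              | Busy s t0 => VBusy (batch_of s) t0
              | Stopping X _ _ => VStopping X
              end).

Definition init_state : state R n m :=
  State 0 finset.set0 (fun=> Idle).

Definition execution (A : online_alg R) (r : nat -> state R n m) : Prop :=
  r 0%N = init_state /\
  forall k, step (A n m (@setup R I) (mkseq (fun l => view_of (r l)) k.+1))
                 (r k) (r k.+1).

(* +oo if some job never completes. *)
Definition makespan (r : nat -> state R n m) : \bar R :=
  ereal_inf (fun t : \bar R => exists2 k : nat,
    completed (r k) = finset.setTfor 'I_n & t = (now (r k))%:E%E).

End Execution.

(* Supremum over the instances in the class P and over all behaviours of the
   machines that the model allows. Since 0^-1 = 0, instances with opt I = 0
   contribute nothing; opt I >= 1 under constant setup times. *)
Definition competitive_ratio (R : realType) (A : online_alg R)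
    (P : instance R -> Prop) : \bar R :=
  ereal_sup (fun x : \bar R => exists (I : instance R)
                             (r : nat -> state R (njobs I) (nmach I)),
    [/\ P I, execution A r & x = (makespan r * ((opt I)^-1)%:E)%E]).

(* Main.v *)
(* Give m of the n jobs, yet to be chosen, length 1 and all others length 0, so
   that the optimum is at most 2. The adversary keeps a set S of undecided jobs,
   none of which the algorithm has managed to complete. Each unit of time it
   restricts S to the jobs held by one machine, or by none, whichever is the
   largest of these m + 1 classes, and declares the first of them in processing
   order to be long. A batch holding the remaining jobs is thereby delayed by
   one unit, while a batch started later needs one unit of setup anyway, so none
   of them completes within the next unit and all ways of choosing the other long
   jobs look the same to the algorithm. As S shrinks by a factor of about m + 1
   per unit of time, n >= (m + 2)^m jobs keep the algorithm busy until time m. *)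
Require Import Defs.
From mathcomp Require Import all_boot all_order all_algebra.
From mathcomp Require Import ring lra.
From mathcomp Require Import boolp classical_sets reals ereal sequences exp.
Import Order.TTheory GRing.Theory Num.Theory.
Local Open Scope ring_scope.

(** * A deterministic behaviour of the machines that the model allows *)

Section CanonicalRun.
Context {R : realType} {I : instance R}.
Local Notation n := (njobs I).
Local Notation m := (nmach I).
Implicit Types (st : state R n m) (s : seq 'I_n) (X : {set 'I_n}) (t : R).

(** [pending] as a finite list, so that a first event can be taken as a minimum. *)
Definition events st : seq R :=
  flatten [seq match mach st i with
               | Idle => [::]
               | Busy s t0 =>
                   [seq completion s t0 j | j <- s & j \notin completed st]
               | Stopping _ _ r => [:: r]
               end | i <- enum 'I_m].

Lemma eventsP st t : (t \in events st) <-> pending st t.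
Proof.
split.
- case/flattenP => l /mapP[i _ ->] tl; exists i; move: tl.
  case: (mach st i) => [//|s t0|X X' r].
  + by case/mapP => j; rewrite mem_filter => /andP[jc js] ->; exists j.
  + by rewrite inE => /eqP.
- case=> i H; apply/flattenP.
  eexists; first by apply/mapP; exists i; [rewrite mem_enum|reflexivity].
  move: H; case: (mach st i) => [//|s t0|X X' r].
  + by case=> j [js jc ->]; apply: map_f; rewrite mem_filter jc.
  + by move=> ->; rewrite inE.
Qed.

(** The only time at which [step] lets [WaitUntil u] return. *)
Definition wait_time st (u : R) : R :=
  \big[Num.min/Num.max (now st) u]_(t <- events st) t.

Lemma wait_time_le_until st u : wait_time st u <= Num.max (now st) u.
Proof. exact: bigmin_le_id. Qed.

Lemma wait_time_le st u t : pending st t -> wait_time st u <= t.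
Proof. by move=> /eventsP te; rewrite /wait_time; exact: ge_bigmin_seq. Qed.

Lemma wait_time_attained st u :
  wait_time st u = Num.max (now st) u \/ pending st (wait_time st u).
Proof.
suff : wait_time st u = Num.max (now st) u \/ wait_time st u \in events st.
  by case=> [|/eventsP]; [left|right].
rewrite /wait_time; elim: (events st) => [|t l IH].
  by rewrite big_nil; left.
rewrite big_cons minEle; case: ifP => _; first by right; rewrite mem_head.
by case: IH => [|IH]; [left|right; rewrite inE IH orbT].
Qed.

(* Among the behaviours allowed by the model: batches are run in the order of
   [enum], and a preempted machine stops at once, keeping what is done. *)
Definition canonical_next (a : action R n m) st : state R n m :=
  match a with
  | Start i X =>
      if startable st i X then set_status st i (Busy (enum X) (now st)) else st
  | Preempt i =>
      if mach st i is Busy s t0 then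
        set_status st i
          (Stopping (batch_of s) (done_by s t0 (now st)) (now st))
      else st
  | WaitUntil u => advance st (wait_time st u)
  end.

(** What makes the canonical behaviour legal: a busy machine still has an unfinished job, and no
    undelivered event lies in the past. *)
Definition wf_status st (x : status R n) : Prop :=
  match x with
  | Idle => True
  | Busy s t0 =>
      [/\ uniq s, ~~ (batch_of s \subset done_by s t0 (now st))
        & forall j, j \in s -> j \notin completed st ->
            now st <= completion s t0 j]
  | Stopping _ _ r => now st <= r
  end.

Definition wf st : Prop :=
  (forall i, wf_status st (mach st i)) /\
  (forall i k, i != k -> [disjoint held (mach st i) & held (mach st k)]).

Hypothesis setup_gt0 : forall X, X != finset.set0 -> 0 < setup X.

Lemma mem_batch_of s j : (j \in batch_of s) = (j \in s).
Proof. by rewrite inE. Qed.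

Lemma batch_of_enum X : batch_of (enum X) = X.
Proof. by apply/setP => j; rewrite mem_batch_of mem_enum. Qed.

Lemma completion_ge s t0 j : t0 + setup (batch_of s) <= completion s t0 j.
Proof. by rewrite lerDl sumr_ge0 // => k _; apply: ptime_ge0. Qed.

Lemma now_le_wait_time st u : wf st -> now st <= wait_time st u.
Proof.
case=> W _; case: (wait_time_attained st u) => [->|]; first by rewrite le_max lexx.
case=> i; move: (W i); case: (mach st i) => [//|s t0|X X' r] /=.
- by case=> _ _ H [j [js jc ->]]; apply: H.
- by move=> ? ->.
Qed.

Lemma sum_ptime_sub (P Q : pred 'I_n) : (forall j, P j -> Q j) ->
  \sum_(j | P j) ptime j <= \sum_(j | Q j) ptime j.
Proof.
move=> PQ; rewrite big_mkcond [leRHS]big_mkcond; apply: ler_sum => j _.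
by case: ifP => [/PQ->//|_]; case: ifP => // _; apply: ptime_ge0.
Qed.

Lemma completion_mono s t0 j k : (index j s <= index k s)%N ->
  completion s t0 j <= completion s t0 k.
Proof.
move=> jk; rewrite lerD2l -(cat_take_drop (index j s).+1 (take (index k s).+1 s)).
by rewrite big_cat take_takel // lerDl sumr_ge0 // => i _; apply: ptime_ge0.
Qed.

Lemma mem_done_by s t0 t j :
  (j \in done_by s t0 t) = (j \in s) && (completion s t0 j <= t).
Proof. by rewrite inE. Qed.

(** All jobs before the first unfinished job [j] are done, so the elapsed time is below setup plus
    [psum D] plus [ptime j]. Conversely, the last job of [D] in processing order completes only
    after all of [D] has been executed. *)
Lemma done_by_legal s t0 t : uniq s -> ~~ (batch_of s \subset done_by s t0 t) ->
  preempt_outcome (batch_of s) (done_by s t0 t) (t - t0) (done_by s t0 t) 0.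
Proof.
move=> us nsub; set D := done_by s t0 t.
have DP j : (j \in D) = (j \in s) && (completion s t0 j <= t) by exact: mem_done_by.
have pm0 : 0 <= pmax (batch_of s) by exact: bigmax_ge_id.
split => //.
- by rewrite lexx /= addr_ge0 ?setup_ge0.
- by apply/fintype.subsetP => j; rewrite DP mem_batch_of => /andP[].
- have hasN : has (fun j => j \notin D) s.
    have /fintype.subsetPn[j] := nsub; rewrite mem_batch_of => js jD.
    by apply/hasP; exists j.
  have [x0 _ _] := hasP hasN.
  set k := find (fun j => j \notin D) s; set j := nth x0 s k.
  have ks : (k < size s)%N by rewrite -has_find.
  have js : j \in s by exact: mem_nth.
  have jD : j \notin D by exact: (nth_find x0 hasN).
  have ij : index j s = k by rewrite index_uniq.
  have : t < completion s t0 j by move: jD; rewrite DP js /= -ltNge.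
  rewrite /completion ij (take_nth x0) // -/j -cats1 big_cat big_seq1 /=.
  have h1 : \sum_(i <- take k s) ptime i <= psum D.
    rewrite big_uniq ?take_uniq //; apply: sum_ptime_sub => i it.
    have := before_find x0 (index_ltn it).
    by rewrite nth_index ?(mem_take it) // => /negbFE.
  have h2 : ptime j <= pmax (batch_of s).
    by rewrite /pmax; apply: le_bigmax_cond; rewrite mem_batch_of.
  lra.
- have [->|/set0Pn[j0 j0D]] := eqVneq D finset.set0; [by left|right].
  rewrite addr0 lerBrDr.
  pose j := [arg max_(i > j0 in D) index i s].
  have [jD jmax] : j \in D /\ forall i, i \in D -> (index i s <= index j s)%N.
    by rewrite /j; case: arg_maxnP => // i iD H; split.
  have := jD; rewrite DP => /andP[js]; apply: le_trans.
  rewrite /completion addrC -addrA lerD2l big_uniq ?take_uniq // lerD2l.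
  apply: sum_ptime_sub => i iD; have := iD; rewrite DP => /andP[is_ _].
  by rewrite in_take // ltnS jmax.
Qed.

Lemma next_legal a st : wf st -> step a st (canonical_next a st).
Proof.
move=> wfst; have [W _] := wfst; case: a => [i X|i|u] /=.
- case: (startable st i X) => //; exists (enum X).
  by rewrite enum_uniq batch_of_enum.
- move: (W i); case: (mach st i) => [//|s t0 [us nd _]|//].
  by exists (done_by s t0 (now st)), 0; rewrite addr0; split=> //; exact: done_by_legal.
- exists (wait_time st u); split=> //.
  + by rewrite now_le_wait_time ?wait_time_le_until.
  + by move=> t; exact: wait_time_le.
  + exact: wait_time_attained.
Qed.

Lemma wf_init : wf (init_state I).
Proof. by split=> // i k _; rewrite disjoint_subset; apply/fintype.subsetP => j; rewrite inE. Qed.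

Lemma wf_set_status st i x : wf st -> wf_status st x ->
  (forall k, k != i -> [disjoint held x & held (mach st k)]) ->
  wf (set_status st i x).
Proof.
case=> W D Wx Dx; split=> /= [k|k l kl].
- by case: ifP => _ //; apply: W.
- case: ifP => [/eqP ki|_]; case: ifP => [/eqP li|_].
  + by rewrite ki li eqxx in kl.
  + by apply: Dx; rewrite -ki eq_sym.
  + by rewrite disjoint_sym; apply: Dx; rewrite -li.
  + exact: D.
Qed.

Lemma wf_advance st t : wf st -> wf (advance st t).
Proof.
case=> W D; split=> /= [i|i k /D].
- move: (W i); rewrite /advance /= ; case E : (mach st i) => [//|s t0|X X' r] /=.
  + case=> us nd H; case: ifP => [//|/negbT nsub]; split=> //= j js.
    rewrite inE negb_or => /andP[_ /bigcupP jn].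
    apply: ltW; rewrite ltNge; apply/negP => le; apply: jn; exists i => //.
    by rewrite E /= mem_done_by js.
  + by move=> _; case: ifP => [//|/negbT]; rewrite -ltNge /= => /ltW.
- have sub x : held (advance_status x t) \subset held x.
    case: x => [//|s t0|X X' r] /=; case: ifP => _ //=; exact: finset.sub0set.
  by apply: disjointW; apply: sub.
Qed.

Lemma wf_next a st : wf st -> wf (canonical_next a st).
Proof.
move=> wfst; have [W D] := wfst; case: a => [i X|i|u] /=; last exact: wf_advance.
- case: ifP => // /and4P[_ X0 _ /forallP dX]; apply: wf_set_status => //=.
    (* Positive setup times keep a batch busy at its start, even if all its jobs have length 0. *)
    have late j : now st < completion (enum X) (now st) j.
      apply: lt_le_trans (completion_ge _ _ _).
      by rewrite ltrDl batch_of_enum setup_gt0.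
    split; [exact: enum_uniq | | by move=> j _ _; exact: ltW].
    have /set0Pn[j jX] := X0; apply/fintype.subsetPn; exists j.
      by rewrite batch_of_enum.
    by rewrite mem_done_by leNgt late andbF.
  by move=> k _; rewrite batch_of_enum.
- case E : (mach st i) => [//|s t0|//]; apply: wf_set_status => //= k ki.
  by have := D i k; rewrite E eq_sym ki; apply.
Qed.

Lemma now_next a st : wf st -> now st <= now (canonical_next a st).
Proof.
case: a => [i X|i|u] wfst /=; last exact: now_le_wait_time.
- by case: ifP.
- by case: (mach st i).
Qed.

Lemma completed_next a st : completed st \subset completed (canonical_next a st).
Proof.
case: a => [i X|i|u] /=; last exact: finset.subsetUl.
- by case: ifP.
- by case: (mach st i).
Qed.

Variable A : online_alg R.

(** An action depends on all earlier views, so the recursion has to carry the whole list of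
    states. *)
Fixpoint history (k : nat) : seq (state R n m) :=
  if k is l.+1 then
    let h := history l in
    rcons h (canonical_next (A n m (@setup R I) (map (@view_of R I) h))
                  (last (init_state I) h))
  else [:: init_state I].

Definition canonical_run (k : nat) : state R n m :=
  last (init_state I) (history k).

Lemma historyE k : history k = mkseq canonical_run k.+1.
Proof.
elim: k => [//|k IH].
by rewrite mkseqS -IH /canonical_run /= last_rcons.
Qed.

Lemma canonical_runS k :
  canonical_run k.+1 =
  canonical_next (A n m (@setup R I) (mkseq (fun l => view_of (canonical_run l)) k.+1))
       (canonical_run k).
Proof.
rewrite {1}/canonical_run /= last_rcons -/(canonical_run k) historyE.
by rewrite /mkseq -map_comp.
Qed.

Lemma wf_canonical_run k : wf (canonical_run k).
Proof. by elim: k => [|k IH]; [exact: wf_init|rewrite canonical_runS; exact: wf_next]. Qed.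

Lemma execution_canonical_run : execution A canonical_run.
Proof.
by split=> // k; rewrite canonical_runS; apply/next_legal/wf_canonical_run.
Qed.

Lemma now_canonical_run k l : (k <= l)%N ->
  now (canonical_run k) <= now (canonical_run l).
Proof.
move/subnK <-; elim: (l - k)%N => [//|d IH]; apply: (le_trans IH).
by rewrite addSn canonical_runS; apply/now_next/wf_canonical_run.
Qed.

Lemma completed_canonical_run k l : (k <= l)%N ->
  completed (canonical_run k) \subset completed (canonical_run l).
Proof.
move/subnK <-; elim: (l - k)%N => [//|d IH]; apply: (fintype.subset_trans IH).
by rewrite addSn canonical_runS completed_next.
Qed.

End CanonicalRun.

(** * Hard instances with unit setups, and steps that cannot tell them apart *)

Section Adversary.
Context {R : realType} {n m : nat}.
Variable nm : (2 <= m <= n)%N.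

Section HardInstance.
Variable L : {set 'I_n}.

Lemma unit_setup_ge0 (X : {set 'I_n}) : 0 <= (X != finset.set0)%:R :> R.
Proof. exact: ler0n. Qed.

Lemma unit_setup_mono (X Y : {set 'I_n}) : X \subset Y ->
  (X != finset.set0)%:R <= (Y != finset.set0)%:R :> R.
Proof.
rewrite ler_nat; case: (eqVneq Y finset.set0) => [->|_ _]; last exact: leq_b1.
by rewrite finset.subset0 => ->.
Qed.

Lemma unit_setup_subadd (X Y : {set 'I_n}) : [disjoint X & Y] ->
  (X :|: Y != finset.set0)%SET%:R <=
  (X != finset.set0)%:R + (Y != finset.set0)%:R :> R.
Proof.
by move=> _; rewrite -natrD ler_nat finset.setU_eq0 negb_and; case: eqP; case: eqP.
Qed.

Lemma indicator_ge0 (j : 'I_n) : 0 <= (j \in L)%:R :> R.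
Proof. exact: ler0n. Qed.

Definition hard_instance : instance R :=
  Instance nm unit_setup_ge0 unit_setup_mono unit_setup_subadd indicator_ge0.

(** Typed over ['I_n], so that completion times under different [L] can be compared. *)
Definition finish : seq 'I_n -> R -> 'I_n -> R := @completion R hard_instance.

Lemma finishE s t0 j : finish s t0 j =
  t0 + (finset (fun k => k \in s) != finset.set0)%:R
     + \sum_(k <- take (index j s).+1 s) (k \in L)%:R.
Proof. by []. Qed.

Lemma hard_setup_gt0 (X : {set 'I_(njobs hard_instance)}) :
  X != finset.set0 -> 0 < setup X.
Proof. by rewrite /= => ->; rewrite ltr01. Qed.

Lemma constant_setup_hard : constant_setup hard_instance.
Proof. by []. Qed.

End HardInstance.

Implicit Types (L C S : {set 'I_n}) (st : state R n m) (b : R).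

(* Under the instance [L], no job of [S] can leave the status [x] completed
   before time [b]. *)
Definition blocked L b S (x : status R n) : Prop :=
  match x with
  | Idle => True
  | Busy s t0 => forall y, y \in s -> y \in S -> b <= finish L s t0 y
  | Stopping _ X' _ => [disjoint S & X']
  end.

Section TwoInstances.
Variables (L L' S : {set 'I_n}) (b : R).
Hypothesis LL' : forall j, j \notin S -> (j \in L) = (j \in L').

(** A candidate run no later than [z] would complete before [b], so only jobs outside [S]
    contribute, and these have equal lengths in both instances. *)
Lemma finish_agree s t0 z : blocked L b S (Busy s t0) -> finish L s t0 z < b ->
  finish L' s t0 z = finish L s t0 z.
Proof.
move=> B zb; rewrite !finishE; congr (_ + _); apply: eq_big_seq => y yt.
rewrite LL' //; apply/negP => yS.
have := B y (mem_take yt) yS; rewrite leNgt => /negP; apply.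
by apply: le_lt_trans zb; apply: completion_mono; rewrite -ltnS index_ltn.
Qed.

End TwoInstances.

Section TwoInstancesStep.
Variables (L L' S : {set 'I_n}) (b : R) (st : state R n m).
Hypothesis LL' : forall j, j \notin S -> (j \in L) = (j \in L').
Hypothesis BL : forall i, blocked L b S (mach st i).
Hypothesis BL' : forall i, blocked L' b S (mach st i).

Lemma done_by_agree i s t0 t : mach st i = Busy s t0 -> t < b ->
  @done_by R (hard_instance L) s t0 t = @done_by R (hard_instance L') s t0 t.
Proof.
move=> E tb; have LL'' : forall j, j \notin S -> (j \in L') = (j \in L).
  by move=> j /LL'.
have := BL i; have := BL' i; rewrite E => B' B.
apply/setP => z.
rewrite (@mem_done_by _ (hard_instance L)) (@mem_done_by _ (hard_instance L')).
congr (_ && _); change ((finish L s t0 z <= t) = (finish L' s t0 z <= t)).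
apply/idP/idP => zt.
- by rewrite (finish_agree _ _ S b LL') // (le_lt_trans zt).
- by rewrite (finish_agree _ _ S b LL'') // (le_lt_trans zt).
Qed.

(** An event under [L] before [b] happens at the same time under [L']. Exchanging the instances then
    gives equality. *)
Lemma wait_time_agree_le u : @wait_time R (hard_instance L) st u < b ->
  @wait_time R (hard_instance L') st u <= @wait_time R (hard_instance L) st u.
Proof.
move=> wb; case: (@wait_time_attained R (hard_instance L) st u).
  by move=> ->; exact: wait_time_le_until.
move=> [i Hi]; apply: wait_time_le; exists i; move: (BL i) Hi.
case: (mach st i) => [//|s t0|//] B [j [js jc E]]; exists j; split => //.
rewrite E; apply/esym/(finish_agree _ _ _ b LL') => //.
by rewrite /finish -E.
Qed.

End TwoInstancesStep.

Lemma next_agree L L' S b st a :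
  (forall j, j \notin S -> (j \in L) = (j \in L')) ->
  (forall i, blocked L b S (mach st i)) ->
  (forall i, blocked L' b S (mach st i)) ->
  now (@canonical_next R (hard_instance L) a st) < b ->
  @canonical_next R (hard_instance L) a st = @canonical_next R (hard_instance L') a st.
Proof.
move=> LL' BL BL'; have L'L : forall j, j \notin S -> (j \in L') = (j \in L).
  by move=> j /LL'.
case: a => [//|i|u] /=.
- case E : (mach st i) => [//|s t0|//] /= nb.
  by rewrite (done_by_agree _ _ _ _ _ LL' BL BL' _ _ _ _ E nb).
- move=> wb; have le := wait_time_agree_le _ _ _ _ _ LL' BL u wb.
  have -> : @wait_time R (hard_instance L') st u =
            @wait_time R (hard_instance L) st u.
    apply: le_anti; rewrite le /=.
    by apply: wait_time_agree_le L'L BL' _ _; apply: le_lt_trans wb.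
  set t := @wait_time R (hard_instance L) st u in wb *.
  rewrite /advance; congr State.
  + congr (_ :|: _)%SET; apply: eq_bigr => i _.
    case E : (mach st i) => [//|s t0|//] /=.
    exact: done_by_agree LL' BL BL' _ _ _ _ E wb.
  + apply: funext => i; case E : (mach st i) => [//|s t0|//] /=.
    by rewrite (done_by_agree _ _ _ _ _ LL' BL BL' _ _ _ _ E wb).
Qed.

(** The bound [b <= now + 1] serves [Start]: a new batch spends one unit on setup, so none of its
    jobs completes before [b]. *)
Lemma next_blocked L S b st a :
  (forall i, blocked L b S (mach st i)) -> [disjoint S & completed st] ->
  now (@canonical_next R (hard_instance L) a st) < b ->
  b <= now (@canonical_next R (hard_instance L) a st) + 1 ->
  (forall i, blocked L b S (mach (@canonical_next R (hard_instance L) a st) i)) /\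
  [disjoint S & completed (@canonical_next R (hard_instance L) a st)].
Proof.
move=> B D.
have dD i s t0 t : mach st i = Busy s t0 -> t < b ->
    [disjoint S & @done_by R (hard_instance L) s t0 t].
  move=> E tb; apply/pred0P => y /=; apply/negP => /andP[yS].
  rewrite (@mem_done_by _ (hard_instance L)) => /andP[ys]; apply/negP; rewrite -ltNge.
  by apply: lt_le_trans tb _; move: (B i); rewrite E; apply.
case: a => [i X|i|u] /=.
- case: (boolP (startable _ _ _)) => // /and4P[_ X0 _ _] _ /= b1.
  split=> // k; case: ifP => // _ y _ yS /=.
  apply: (le_trans b1); apply: le_trans (completion_ge _ _ _).
  by rewrite batch_of_enum /= X0.
- case E : (mach st i) => [//|s t0|//] /= nb _; split=> // k.
  by case: ifP => // _ /=; exact: dD E nb.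
- move=> wb _; set t := @wait_time R (hard_instance L) st u in wb *; split.
  + move=> i; move: (B i); case: (mach st i) => [//|s t0|X X' r] /=; by case: ifP.
  + rewrite -finset.setI_eq0 finset.setIUr finset.setU_eq0 !finset.setI_eq0 D /=.
    apply: finset.bigcup_disjoint => i _.
    case E : (mach st i) => [|s t0|X X' r] /=; [|exact: dD E wb|].
      by rewrite -finset.setI_eq0 finset.setI0.
    have := B i; rewrite E /=; case: ifP => // _ _.
    by rewrite -finset.setI_eq0 finset.setI0.
Qed.

(** * The adversary against a fixed algorithm *)

Variable A : online_alg R.

Definition run L : nat -> state R n m := @canonical_run R (hard_instance L) A.

Lemma wf_run L k : @wf R (hard_instance L) (run L k).
Proof. by apply: wf_canonical_run; exact: hard_setup_gt0. Qed.

Lemma now_run L k l : (k <= l)%N -> now (run L k) <= now (run L l).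
Proof. by apply: now_canonical_run; exact: hard_setup_gt0. Qed.

Lemma completed_run L k l : (k <= l)%N ->
  completed (run L k) \subset completed (run L l).
Proof. exact: (@completed_canonical_run R (hard_instance L) A). Qed.

(* The long jobs of an instance are [C], the ones committed so far, and some of
   the candidates [S]. *)
Definition admissible C S L : Prop := (C \subset L) && (L \subset C :|: S)%SET.

(** The adversary's invariant after [k] steps: the choice among the candidates has left no trace in
    the run, and the batches now held complete no candidate before time [b]. *)
Definition undecided b C S k : Prop :=
  (forall L L', admissible C S L -> admissible C S L' ->
     forall j, (j <= k)%N -> run L j = run L' j) /\
  (forall L, admissible C S L -> [disjoint S & completed (run L k)] /\
     forall i, blocked L b S (mach (run L k) i)).

Lemma admissible_agree {C S L L'} : admissible C S L -> admissible C S L' ->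
  forall j, j \notin S -> (j \in L) = (j \in L').
Proof.
move=> /andP[CL LS] /andP[CL' L'S] j jS; apply/idP/idP => jL.
- have := fintype.subsetP LS j jL; rewrite inE (negbTE jS) orbF.
  exact: (fintype.subsetP CL').
- have := fintype.subsetP L'S j jL; rewrite inE (negbTE jS) orbF.
  exact: (fintype.subsetP CL).
Qed.

Lemma admissible_committed C S : admissible C S C.
Proof. by rewrite /admissible fintype.subxx finset.subsetUl. Qed.

Lemma admissible_commit C S S' x L : x \in S -> S' \subset S ->
  admissible (x |: C)%SET S' L -> admissible C S L.
Proof.
move=> xS S'S /andP[CL LS]; apply/andP; split.
  by apply: fintype.subset_trans CL; exact: finset.subsetUr.
apply: (fintype.subset_trans LS); rewrite finset.subUset finset.subUset.
rewrite finset.sub1set inE xS orbT finset.subsetUl /=.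
by apply: (fintype.subset_trans S'S); exact: finset.subsetUr.
Qed.

(** Only lengths of completed jobs are visible, and no candidate is completed. *)
Lemma view_of_agree {L L' S st} :
  (forall j, j \notin S -> (j \in L) = (j \in L')) ->
  [disjoint S & completed st] ->
  @view_of R (hard_instance L) st = @view_of R (hard_instance L') st.
Proof.
move=> LL' D; rewrite /view_of; congr View; apply: funext => j.
by case: ifP => // jc; rewrite /= LL' // (disjointFl D jc).
Qed.

(** If the next step ends before [b] under a single admissible [L0], it has the same outcome under
    all of them: equal views give equal actions, and [next_agree] applies. Without such an [L0] the
    second alternative holds. *)
Lemma undecided_step b C S k : undecided b C S k ->
  (forall L, admissible C S L -> b <= now (run L k.+1) + 1) ->
  undecided b C S k.+1 \/ forall L, admissible C S L -> b <= now (run L k.+1).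
Proof.
move=> [same pend] late.
case: (pselect (forall L, admissible C S L -> b <= now (run L k.+1))) => [|early].
  by right.
left; move/existsNP : early => [L0 /not_implyP [aL0 /negP]].
rewrite -ltNge => early.
pose a L := A n m (@setup R (hard_instance L))
  (mkseq (fun l => @view_of R (hard_instance L) (run L l)) k.+1).
have runS L : run L k.+1 = @canonical_next R (hard_instance L) (a L) (run L k).
  exact: (@canonical_runS R (hard_instance L) A k).
have aE L : admissible C S L -> a L = a L0.
  move=> aL; congr (A n m _ _); apply/eq_in_map => l; rewrite mem_iota /= => lk.
  have lk' : (l <= k)%N by [].
  rewrite (same L L0 aL aL0 l lk'); apply: (view_of_agree (admissible_agree aL aL0)).
  have [D _] := pend L0 aL0; apply: disjointWr D.
  exact: completed_run.
have next_eq L : admissible C S L -> run L k.+1 = run L0 k.+1.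
  move=> aL; rewrite !runS (aE L aL) (same L L0 aL aL0 k (leqnn k)).
  have [_ B] := pend L aL; have [_ B0] := pend L0 aL0.
  rewrite (same L L0 aL aL0 k (leqnn k)) in B.
  apply/esym/(next_agree _ _ _ _ _ _ (admissible_agree aL0 aL) B0 B).
  by rewrite -runS.
split.
- move=> L L' aL aL' j; rewrite leq_eqVlt => /orP[/eqP->|].
    by rewrite !next_eq.
  by rewrite ltnS; exact: same.
- move=> L aL; have [D B] := pend L aL.
  have [] := next_blocked L S b (run L k) (a L) B D; rewrite -?runS.
  + by rewrite next_eq.
  + exact: late.
  + by move=> *; split.
Qed.

Definition batch_order (x : status R n) : seq 'I_n :=
  if x is Busy s _ then s else [::].

Lemma finish_commit L s t0 x : x \in s -> x \in L ->
  finish (L :\ x)%SET s t0 x + 1 <= finish L s t0 x.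
Proof.
move=> xs xL; rewrite !finishE -addrA lerD2l.
rewrite (take_nth x) ?index_mem // nth_index // -cats1 !big_cat !big_seq1 /=.
rewrite xL !inE eqxx addr0 lerD2r; apply: ler_sum => j _.
by rewrite !inE ler_nat; case: (j == x) => //=.
Qed.

(* The invariant survives one unit of time longer: among the candidates keep
   those lying on one machine (or on none), and commit the one that is to be run
   first; it delays all the others by one. *)
Lemma commit q C S k (a : nat) : undecided q C S k -> [disjoint C & S] ->
  (m.+1 * a < #|S|)%N ->
  exists x S', [/\ x \in S, x \notin S', S' \subset S, (a <= #|S'|)%N
    & undecided (q + 1) (x |: C)%SET S' k].
Proof.
move=> [same pend] CS aS.
have aC := admissible_committed C S.
set st := run C k.
have stE L : admissible C S L -> run L k = st by move=> aL; apply: same.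
(* [None] stands for jobs held by no machine; the [m.+1] classes explain the factor in the
   hypothesis. *)
pose g y : option 'I_m := [pick i | y \in @held R (hard_instance C) (mach st i)].
(* Pigeonhole. The strict bound leaves [a] candidates after [x] is removed. *)
have [v av] : exists v, (a < #|finset (fun y => (y \in S) && (g y == v))|)%N.
  apply/existsP; apply: contraLR aS; rewrite negb_exists => /forallP small.
  rewrite -leqNgt -sum1_card (partition_big g xpredT) //=.
  apply: (@leq_trans (\sum_(v : option 'I_m) a)%N); last first.
    by rewrite sum_nat_const card_option card_ord.
  apply: leq_sum => v _; rewrite sum1_card.
  have := small v; rewrite -leqNgt; apply: leq_trans.
  by apply: subset_leq_card; apply/fintype.subsetP => y; rewrite !inE.
set S1 := finset _ in av.
have [y0 y0S1] : exists y, y \in S1.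
  by apply/finset.set0Pn; rewrite -card_gt0; apply: leq_trans av.
(* Off a busy machine there is no order to respect: [s] is empty and any [x] in the class serves. *)
pose s := if v is Some i then batch_order (mach st i) else [::].
pose x := [arg min_(y < y0 in S1) index y s].
have [xS1 xmin] : x \in S1 /\ forall y, y \in S1 -> (index x s <= index y s)%N.
  by rewrite /x; case: arg_minnP => // y yS1 H; split.
have S1S : S1 \subset S by apply/fintype.subsetP => y; rewrite inE => /andP[].
have xS : x \in S := fintype.subsetP S1S x xS1.
have xC : x \notin C by rewrite (disjointFl CS xS).
exists x, (S1 :\ x)%SET.
have S'S : (S1 :\ x)%SET \subset S.
  by apply: fintype.subset_trans S1S; exact: finset.subD1set.
have adm L := admissible_commit C S (S1 :\ x)%SET x L xS S'S.
split=> //.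
- by rewrite !inE eqxx.
- by move: av; rewrite (finset.cardsD1 x S1) xS1.
split=> [L L' aL aL'|L aL]; first by apply: same; apply: adm.
have aL0 := adm L aL; have [D B] := pend L aL0.
split=> [|i]; first by apply: disjointWl D.
have stL := stE L aL0; move: (B i); rewrite stL.
case E : (mach st i) => [//|s' t0|X X' r] /= Bi; last exact: disjointWl Bi.
move=> y ys'; rewrite !inE => /andP[yx /andP[yS gy]].
(* Held batches are disjoint, so [y] on machine [i] forces [v] to be the class of [i]. *)
have [ss' xy] : s = s' /\ (index x s <= index y s)%N.
  split; last by apply: xmin; rewrite inE yS.
  have yi : y \in @held R (hard_instance L) (mach st i).
    by rewrite E /= (@mem_batch_of R (hard_instance L)).
  move: gy; rewrite /s /g; case: pickP => [i' yi'|/(_ i)]; last first.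
    by rewrite [X in X = _ -> _]yi.
  move=> /eqP <-; suff -> : i' = i by rewrite /= E.
  apply/eqP; apply: contraTT yi => ii'.
  have [_ /(_ i' i ii')] := wf_run L k; rewrite stL => dis.
  by rewrite (disjointFr dis yi').
rewrite ss' in xy.
have xs' : x \in s' by rewrite -index_mem (leq_ltn_trans xy) // index_mem.
have xL : x \in L.
  by case/andP: aL => /fintype.subsetP CL _; apply: CL; rewrite !inE eqxx.
(* Compare with [L] without [x], which is admissible for [C] and [S]: there [x] completes no earlier
   than [q], so under [L] no earlier than [q + 1], and [y] comes after [x]. *)
apply: (@le_trans _ _ (finish L s' t0 x)); last exact: completion_mono.
apply: le_trans (finish_commit L s' t0 x xs' xL).
have aLx : admissible C S (L :\ x)%SET.
  case/andP: aL0 => CL LS; apply/andP; split.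
    apply/fintype.subsetP => z zC; rewrite !inE (fintype.subsetP CL z zC) andbT.
    by apply: contraNneq xC => <-.
  by apply: fintype.subset_trans LS; exact: finset.subD1set.
have [_ /(_ i)] := pend _ aLx; rewrite stE // E => /(_ x xs' xS) ?.
by rewrite lerD2r.
Qed.

(** Induction on the number [d] of rounds left. A round starts just before the step that reaches
    time [q], commits one long job, and lasts until the step that reaches [q + 1] in every
    admissible run. *)
Lemma adversary d (q : nat) C S k : undecided q%:R C S k ->
  (forall L, admissible C S L -> q%:R <= now (run L k.+1)) ->
  [disjoint C & S] -> (m.+2 ^ d <= #|S|)%N ->
  exists L, (#|L| <= #|C| + d)%N /\
    forall l, now (run L l) < (q + d)%:R -> completed (run L l) != finset.setT.
Proof.
have notT L S' l l' : (l <= l')%N -> [disjoint S' & completed (run L l')] ->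
    (0 < #|S'|)%N -> completed (run L l) != finset.setT.
  move=> ll' D /card_gt0P[y yS]; apply/eqP => T.
  have := fintype.subsetP (completed_run L l l' ll') y.
  by rewrite T inE (disjointFr D yS) => /(_ isT).
elim: d q C S k => [|d IH] q C S k U late CS dS.
  exists C; rewrite !addn0; split=> // l lq.
  have [D _] := U.2 C (admissible_committed C S).
  apply: notT D _; last by rewrite expn0 in dS.
  rewrite leqNgt; apply/negP => kl.
  have := le_lt_trans (now_run C k.+1 l kl) lq.
  by rewrite ltNge late //; exact: admissible_committed.
(* The base [m.+2] rather than [m.+1] yields the strict inequality that [commit] asks for. *)
have aS : (m.+1 * m.+2 ^ d < #|S|)%N.
  apply: leq_trans dS; rewrite expnS ltn_pmul2r ?expn_gt0 //.
have [x [S' [xS xS' S'S dS' U']]] := commit _ _ _ _ _ U CS aS.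
have S'0 : (0 < #|S'|)%N by apply: leq_trans dS'; rewrite expn_gt0.
have xC : x \notin C by rewrite (disjointFl CS xS).
have CS' : [disjoint (x |: C)%SET & S'].
  rewrite -finset.setI_eq0 finset.setIUl finset.setU_eq0 !finset.setI_eq0.
  by rewrite finset.disjoints1 xS' /=; apply: disjointWr CS.
have adm L := admissible_commit C S S' x L xS S'S.
have cC : #|(x |: C)%SET| = #|C|.+1 by rewrite finset.cardsU1 xC.
rewrite natr1 in U'.
(* If the invariant never fails, the algorithm never completes all jobs. *)
case: (pselect (forall l, (k <= l)%N -> undecided q.+1%:R (x |: C)%SET S' l)) => [ever|].
  exists (x |: C)%SET; split; first by rewrite cC addnS leq_addr.
  move=> l _; have [D _] := (ever (maxn k l) (leq_maxl _ _)).2 _ (admissible_committed _ _).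
  exact: notT (leq_maxr k l) D S'0.
move=> /existsNP[l /not_implyP[kl nU]].
(* A step at which the invariant holds and right after which it fails; the next round starts
   here. *)
have [l' [kl' Ul' nUl']] : exists l', [/\ (k <= l')%N,
    undecided q.+1%:R (x |: C)%SET S' l' & ~ undecided q.+1%:R (x |: C)%SET S' l'.+1].
  apply: contrapT => none; apply: nU; rewrite -(subnK kl).
  elim: (l - k)%N => [//|e IHe]; apply: contrapT => nUe; apply: none.
  by exists (e + k)%N; rewrite leq_addl.
have late' L : admissible (x |: C)%SET S' L -> q.+1%:R <= now (run L l'.+1) + 1.
  move=> aL; rewrite -natr1 lerD2r; apply: (le_trans (late L (adm L aL))).
  exact: now_run.
have [/nUl' []|late''] := undecided_step _ _ _ _ Ul' late'.
have [L [cL HL]] := IH q.+1 _ _ _ Ul' late'' CS' dS'.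
exists L; rewrite -addSnnS -cC; split=> // z; rewrite addnS -addSn; exact: HL.
Qed.

(** Play [m] rounds from time 0 with all jobs undecided; up to [m] long jobs can still be spread one
    to a machine. *)
Lemma slow_instance : (m.+2 ^ m <= n)%N ->
  exists L, (#|L| <= m)%N /\
    forall l, now (run L l) < m%:R -> completed (run L l) != finset.setT.
Proof.
move=> mn; have [||||L] := adversary m 0 finset.set0 finset.setT 0; last 1 first.
- by rewrite finset.cards0 !add0n; exists L.
- split=> [L L' _ _ j|L _]; first by rewrite leqn0 => /eqP ->.
  by split=> //; rewrite -finset.setI_eq0 finset.setI0.
- by move=> L _; exact: (now_run L 0 1).
- by rewrite -finset.setI_eq0 finset.set0I.
- by rewrite finset.cardsT card_ord.
Qed.

Lemma makespan_run L (t : R) :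
  (forall l, now (run L l) < t -> completed (run L l) != finset.setT) ->
  (t%:E <= @makespan R (hard_instance L) (run L))%E.
Proof.
move=> H; apply/ereal_infP => _ [l T ->]; rewrite lee_fin leNgt; apply/negP => lt.
by have := H l lt; rewrite T eqxx.
Qed.

(** * The optimum of a hard instance, and the resulting ratio *)

Lemma machine_gt0 : (0 < m)%N.
Proof. by case/andP: nm => /ltnW. Qed.

Lemma job_gt0 : (0 < n)%N.
Proof. by case/andP: nm => _; apply: leq_trans machine_gt0. Qed.

(** The machine that receives job [j] pays a setup. This bounds the infimum [opt] from below and
    keeps it away from 0, where the inverse would be 0. *)
Lemma offline_makespan_ge1 L f : 1 <= @offline_makespan R (hard_instance L) f.
Proof.
pose j := Ordinal job_gt0.
apply: le_trans (le_bigmax _ _ (f j)); rewrite -[X in X <= _]addr0 lerD //.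
  by rewrite /= ler1n lt0b; apply/finset.set0Pn; exists j; rewrite inE.
by apply: sumr_ge0 => i _; exact: ptime_ge0.
Qed.

Lemma opt_hard_ge1 L : 1 <= opt (hard_instance L).
Proof.
apply: lb_le_inf; last by move=> _ [f _ <-]; exact: offline_makespan_ge1.
by exists (@offline_makespan R (hard_instance L) [ffun=> Ordinal machine_gt0]),
  [ffun=> Ordinal machine_gt0].
Qed.

(* Each machine receives at most one long job. *)
Lemma opt_hard_le2 L : (#|L| <= m)%N -> opt (hard_instance L) <= 2.
Proof.
(* Long jobs go to machines by their rank in [enum L]; the others have length 0, so it does not
   matter where [insubd] sends them. *)
move=> Lm; pose f : {ffun 'I_n -> 'I_m} :=
  [ffun j => insubd (Ordinal machine_gt0) (index j (enum L))].
apply: (@le_trans _ _ (@offline_makespan R (hard_instance L) f)).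
  apply: ge_inf; last by exists f.
  by exists 1 => _ [g _ <-]; exact: offline_makespan_ge1.
apply: bigmax_le => // i _; rewrite -[2]/(1 + 1) lerD //=; first by rewrite lern1 leq_b1.
rewrite /psum /= -natr_sum lern1 -big_mkcondr sum1_card.
apply/card_le1_eqP => j k /andP[]; rewrite inE ffunE => /eqP ij jL.
case/andP; rewrite inE ffunE => /eqP ik kL.
have fE z : z \in L ->
    val (insubd (Ordinal machine_gt0) (index z (enum L))) = index z (enum L).
  move=> zL; rewrite val_insubd; case: ifP => //.
  by rewrite (leq_trans _ Lm) // cardE index_mem mem_enum.
have : index j (enum L) = index k (enum L) by rewrite -fE // -[RHS]fE // ij ik.
by move/esym/index_inj => -> //; rewrite mem_enum.
Qed.

Lemma competitive_ratio_hard P : (m.+2 ^ m <= n)%N ->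
  (forall L, P (hard_instance L)) ->
  ((m%:R / 2)%:E <= competitive_ratio A P)%E.
Proof.
move=> mn PL; have [L [Lm /makespan_run slow]] := slow_instance mn.
apply: (@le_trans _ _ (@makespan R (hard_instance L) (run L)
                        * ((opt (hard_instance L))^-1)%:E)%E).
  rewrite EFinM lee_pmul ?lee_fin ?invr_ge0 //.
  by rewrite lef_pV2 ?posrE ?opt_hard_le2 // (lt_le_trans ltr01) ?opt_hard_ge1.
apply: ereal_sup_ubound; exists (hard_instance L), (run L); split=> //.
by apply: execution_canonical_run; exact: hard_setup_gt0.
Qed.

End Adversary.

(** * The number of machines for a given number of jobs *)

Lemma exists_machine_number (R : realType) (n : nat) :
  ((Num.truncn (expR (expR 12%:R) : R)).+2 <= n)%N ->
  exists m : nat, [/\ (2 <= m <= n)%N, (m.+2 ^ m <= n)%N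
    & 8^-1 * (ln n%:R / ln (ln n%:R)) <= m%:R / 2 :> R].
Proof.
move=> Nn; set x : R := ln n%:R; set y : R := ln x.
have en : expR (expR 12%:R) <= n%:R :> R.
  apply: ltW; rewrite -truncn_lt_nat ?expR_ge0 //.
  exact: leq_ltn_trans Nn.
have n0 : 0 < n%:R :> R by apply: lt_le_trans en; exact: expR_gt0.
have ex : expR 12%:R <= x by rewrite -ler_expR lnK.
have x0 : 0 < x by apply: lt_le_trans ex; exact: expR_gt0.
have y12 : 12%:R <= y by rewrite -ler_expR lnK.
(* Here [x = expR y] is at least [(1 + y / 2) ^+ 2], whose quadratic term [y ^+ 2 / 4] is at least
   [3 * y] once [y >= 12]; this fixes the constant 12. *)
have xy : 4 * y <= x.
  rewrite -[x]lnK // -/y.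
  have -> : y = y / 2 + y / 2 by lra.
  rewrite expRD; have h := expR_ge1Dx (y / 2).
  apply: (@le_trans _ _ ((1 + y / 2) * (1 + y / 2))); first by nra.
  by apply: ler_pM => //; lra.
have x48 : 48%:R <= x by apply: le_trans xy; lra.
(* The factor 2 pays for [m + 2 <= x ^+ 2]: then [m * ln (m + 2) <= z * (2 * y) = x], which is [mn]
   in logarithms. *)
set z := x / (2 * y).
have zy : z * (2 * y) = x by rewrite /z divfK //; lra.
have z0 : 0 <= z by rewrite divr_ge0 //; lra.
have z2 : 2 <= z by rewrite /z ler_pdivlMr; lra.
have /andP[mz zm] := truncn_itv z0.
set m := Num.truncn z in mz zm *.
have m2 : (2 <= m)%N by rewrite truncn_ge_nat.
have mn : (m.+2 ^ m <= n)%N.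
  rewrite -(ler_nat R) natrX -ler_ln ?posrE ?exprn_gt0 ?ltr0Sn //.
  rewrite lnXn ?ltr0Sn // -/x.
  have lm : ln m.+2%:R <= 2 * y.
    have -> : 2 * y = ln (x ^+ 2) by rewrite lnXn // -/y mulr2n mulrDl mul1r.
    rewrite ler_ln ?posrE ?ltr0Sn ?exprn_gt0 // -addn2 natrD.
    have : z <= x by rewrite /z ler_pdivrMr; nra.
    by rewrite expr2; nra.
  have l0 : 0 <= ln m.+2%:R :> R by apply: ln_ge0; rewrite ler1n.
  rewrite -[_ *+ _]mulr_natl -zy; exact: ler_pM.
exists m; split=> //.
  by rewrite m2 /=; apply: leq_trans mn; apply: ltnW; apply: leq_ltn_trans (ltn_expl m _).
(* It remains that [z / 4 <= m / 2], which holds since [m > z - 1] and [z >= 2]. *)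
have -> : x / y = 2 * z by rewrite /z; field; lra.
by rewrite -natr1 in zm; lra.
Qed.

Theorem theorem7 (R : realType) :
  exists C : R, 0 < C /\
  exists N : nat, forall A : online_alg R,
    (forall m : nat, (N <= m)%N ->
       ((C * m%:R)%:E <=
        competitive_ratio A
          (fun I => constant_setup I /\ nmach I = m))%E) /\
    (forall n : nat, (N <= n)%N ->
       ((C * (ln n%:R / ln (ln n%:R)))%:E <=
        competitive_ratio A
          (fun I => constant_setup I /\ njobs I = n))%E).
Proof.
(* The bound in [n] dictates this constant; the bound in [m] is proved with 1/2, on exactly
   [m.+2 ^ m] jobs. *)
exists 8^-1; split; first by rewrite invr_gt0.
exists (Num.truncn (expR (expR 12%:R) : R)).+2 => A; split=> [m Nm|n Nn].
- have m2 : (2 <= m)%N by apply: leq_trans Nm.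
  have nm : (2 <= m <= m.+2 ^ m)%N.
    rewrite m2 (leq_trans (leqnSn m)) // (leq_trans (leqnSn _)) //.
    by rewrite -[leqLHS]expn1 leq_pexp2l // ltnW.
  apply: le_trans (competitive_ratio_hard nm A _ (leqnn _) _).
    by rewrite lee_fin mulrC ler_wpM2l // lef_pV2 ?posrE // ler_nat.
  by move=> L; split=> //; exact: constant_setup_hard.
- have [m [nm mn le]] := exists_machine_number R n Nn.
  apply: le_trans (competitive_ratio_hard nm A _ mn _); first by rewrite lee_fin.
  by move=> L; split=> //; exact: constant_setup_hard.
Qed.
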